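(* Let $(T_\xi)$ be a family of operators $T_\xi\colon\mathcal H\to\mathcal H$, with $\xi\sim\mathcal D$, such that $T_\xi$ is nonexpansive for $\mathcal D$-almost all $\xi$ and, for each $x\in\mathcal H$, the map $\xi\mapsto T_\xi x$ is measurable and Bochner integrable. Define $T\colon\mathcal H\to\mathcal H$ by $Tx=\mathbb E_{\xi\sim\mathcal D}[T_\xi x]$ and assume $\mathrm{Fix}(T)\neq\emptyset$. Assume that there exist some $p_0\in\mathrm{Fix}(T)$ and a constant $\sigma_*^2<+\infty$ such that $\mathbb E[\|(T_\xi-T)p_0\|^2]\le\sigma_*^2$. Then, for all $x\in\mathcal H$ and all $p\in\mathrm{Fix}(T)$, $$\mathbb E\left[\|(T_\xi-T)x\|^2\right]\le 2\sigma_*^2+2\|x-p\|^2.$$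
   Context: $\mathcal H$ is a real separable Hilbert space with norm $\|\cdot\|$, and $\mathcal D$ is a probability distribution. An operator $S\colon\mathcal H\to\mathcal H$ is nonexpansive if $\|Sx-Sy\|\le\|x-y\|$ for all $x,y\in\mathcal H$. $\mathrm{Fix}(T)=\{x\in\mathcal H\colon Tx=x\}$. $\mathbb E$ denotes expectation over $\xi\sim\mathcal D$. *)

(* Defs.v *)
From HB Require Import structures.
From mathcomp Require Import all_boot all_order all_algebra sesquilinear.
From mathcomp Require Import all_classical all_reals all_analysis.

Set Implicit Arguments.
Unset Strict Implicit.
Unset Printing Implicit Defensive.

Import Order.TTheory GRing.Theory Num.Theory.
Import numFieldNormedType.Exports.

Local Open Scope classical_set_scope.
Local Open Scope ring_scope.

Definition separable (X : topologicalType) : Prop :=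
  exists2 S : set X, countable S & dense S.

(* The norm of H is the one of the inner product ip: a complete normed module
   with such an ip is a real Hilbert space. *)
Definition norm_from_dot (R : realType) (H : normedModType R)
    (ip : {dot H for idfun}) : Prop :=
  forall x : H, `|x| = Num.sqrt (ip x x).

Definition nonexpansive (R : realType) (H : normedModType R) (S : H -> H) :
    Prop :=
  forall x y : H, `|S x - S y| <= `|x - y|.

Definition Fix (X : Type) (S : X -> X) : set X := [set x | S x = x].

Section Bochner.
Context (d : measure_display) (Xi : measurableType d) (R : realType)
        (H : completeNormedModType R).

(* The codomain carries the Borel sigma-algebra of the norm topology. *)
Definition borel_measurable (f : Xi -> H) : Prop :=
  measurable_fun [set: Xi] (f : Xi -> g_sigma_algebraType (@open H)).

Definition simple_fun (s : Xi -> H) : Prop :=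
  borel_measurable s /\ finite_set (range s).

Variable P : probability Xi R.

Definition simple_integral (s : Xi -> H) : H :=
  \sum_(v \in range s) fine (P (s @^-1` [set v])) *: v.

(* Convergence in mean of simple functions to f; this is meaningful when f is
   Borel measurable, so that the integrands are measurable. *)
Definition simple_approx (f : Xi -> H) (s : nat -> Xi -> H) : Prop :=
  (forall n, simple_fun (s n)) /\
  (\int[P]_xi (`|f xi - s n xi|)%:E)%E @[n --> \oo] --> 0%E.

Definition bochner_integrable (f : Xi -> H) : Prop :=
  borel_measurable f /\ exists s, simple_approx f s.

(* The limit v exists, by completeness of H, and does not depend on s when f is
   Bochner integrable; otherwise the value is irrelevant. *)
Definition bochner_integral (f : Xi -> H) : H :=
  get [set v : H | exists2 s, simple_approx f s &
                     simple_integral (s n) @[n --> \oo] --> v].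

End Bochner.

(* Main.v *)
Require Import Defs.
From HB Require Import structures.
From mathcomp Require Import all_boot all_order all_algebra sesquilinear.
From mathcomp Require Import all_classical all_reals all_analysis.
From mathcomp Require Import finmap ring lra measurable_realfun.

(** A Bochner integrable [f] satisfies <E f, w> = E <f, w> for every [w]: this
    holds for simple functions and passes to the limit by Cauchy-Schwarz, which
    also gives the Cauchy property, hence existence of the Bochner integral.
    Put [c = T x - T p]. Nonexpansiveness yields, almost surely,
      |T_xi x - T_xi p - c|^2 <= |x - p|^2 - 2 <T_xi x - T_xi p, c> + |c|^2,
    and the right-hand side has mean |x - p|^2 - |c|^2. If [x] and [p] are both
    fixed points this mean is [0], so T_xi x - x = T_xi p - p almost surely:
    the variance at a fixed point does not depend on the fixed point. The
    theorem follows from |a + b|^2 <= 2 |a|^2 + 2 |b|^2 with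
    a = T_xi p - T p and b = T_xi x - T_xi p - c. *)

Set Implicit Arguments.
Unset Strict Implicit.
Unset Printing Implicit Defensive.

Import Order.TTheory GRing.Theory Num.Theory.
Import numFieldNormedType.Exports.

Local Open Scope classical_set_scope.
Local Open Scope ring_scope.

(** * Inner product identities, Cauchy-Schwarz and continuity *)

Section DotNorm.
Context (R : realType) (H : normedModType R) (ip : {dot H for idfun})
  (ip_norm : norm_from_dot ip).

Lemma dot_sym (x y : H) : ip x y = ip y x.
Proof. by rewrite hermC expr0 mul1r. Qed.

(* The generic bilinear lemmas leave [ip] coerced through Bilinear, which blocks
   further rewriting; the next ones restate them on the Dot structure. *)
Lemma dotDl (x y z : H) : ip (x + y) z = ip x z + ip y z.
Proof. exact: linearDl. Qed.

Lemma dotBl (x y z : H) : ip (x - y) z = ip x z - ip y z.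
Proof. exact: linearBl. Qed.

Lemma dotZl (a : R) (x y : H) : ip (a *: x) y = a * ip x y.
Proof. exact: linearZl_LR. Qed.

Lemma dot0l (x : H) : ip 0 x = 0.
Proof. exact: linear0l. Qed.

Lemma dotNr (x y : H) : ip x (- y) = - ip x y.
Proof. exact: linearNr. Qed.

Lemma dot_normE (x : H) : ip x x = `|x| ^+ 2.
Proof.
rewrite ip_norm sqr_sqrtr//; have [->|x0] := eqVneq x 0.
  by rewrite dot0l.
exact/ltW/neq0_dnorm_gt0.
Qed.

Lemma dot_normD (x y : H) : `|x + y| ^+ 2 = `|x| ^+ 2 + 2 * ip x y + `|y| ^+ 2.
Proof.
by rewrite -!dot_normE dotDl !(dot_sym _ (x + y)) !dotDl (dot_sym y x); ring.
Qed.

Lemma dot_normB (x y : H) : `|x - y| ^+ 2 = `|x| ^+ 2 - 2 * ip x y + `|y| ^+ 2.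
Proof. by rewrite dot_normD dotNr normrN mulrN. Qed.

(** Polarization: continuity of [ip] in its first argument reduces to that of the norm. *)
Lemma dot_polar (x y : H) :
  ip x y = 2^-1 * (`|x + y| ^+ 2 - `|x| ^+ 2 - `|y| ^+ 2).
Proof. by rewrite dot_normD; field. Qed.

(** Cauchy-Schwarz comes from squaring the triangle inequality for x + y and for x - y: the squared
    norms cancel, leaving the upper and the lower bound on [ip x y]. *)
Lemma dot_le_norm (x y : H) : `|ip x y| <= `|x| * `|y|.
Proof.
have le_sqr (u v : H) : `|u + v| ^+ 2 <= (`|u| + `|v|) ^+ 2.
  by rewrite ler_sqr ?nnegrE ?addr_ge0// ler_normD.
have := le_sqr x y; have := le_sqr x (- y).
rewrite normrN dot_normB dot_normD => h1 h2.
by rewrite ler_norml; apply/andP; split; nra.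
Qed.

Lemma continuous_dot (y : H) : continuous (ip^~ y).
Proof.
rewrite (_ : ip^~ y = fun x => 2^-1 * (`|x + y| ^+ 2 - `|x| ^+ 2 - `|y| ^+ 2));
  last by apply/funext => x; exact: dot_polar.
move=> x; apply: cvgMr; apply: cvgB; last exact: cvg_cst.
apply: cvgB; apply: cvgM; apply: cvg_norm => //;
  by apply: cvgD => //; exact: cvg_cst.
Qed.

End DotNorm.

(** * Measurability of real functions of Borel maps *)

Section BorelMeasurable.
Context (d : measure_display) (Xi : measurableType d) (R : realType)
        (H : completeNormedModType R).

Lemma borel_measurable_comp (g : H -> R) (f : Xi -> H) :
  continuous g -> borel_measurable f -> measurable_fun setT (g \o f).
Proof.
move=> /continuousP cg mf.
apply: (measurability _ (RGenOpens.measurableE R)).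
move=> _ [_ [a [b ->] <-]]; rewrite comp_preimage.
by apply: mf => //; apply: sub_sigma_algebra; exact/cg/interval_open.
Qed.

Lemma borel_measurable_fiber (f : Xi -> H) (v : H) :
  borel_measurable f -> measurable (f @^-1` [set v]).
Proof.
move=> mf; rewrite -[X in measurable X]setTI.
have <- : ~` ~` [set v] = [set v] by rewrite setCK.
apply: mf => //; apply: (@measurableC _ (g_sigma_algebraType (@open H))).
apply: sub_sigma_algebra; apply: closed_openC.
exact/accessible_closed_set1/hausdorff_accessible/norm_hausdorff.
Qed.

(** On each of the finitely many fibers of s, the function is |f - v| with v constant, a continuous
    function of f. No measurability of the difference of two Borel maps is involved. *)
Lemma measurable_normB (f s : Xi -> H) :
  borel_measurable f -> simple_fun s ->
  measurable_fun setT (fun xi => `|f xi - s xi|).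
Proof.
move=> mf [ms fs] _ Y mY; rewrite setTI.
rewrite (_ : _ @^-1` _ = \bigcup_(v in range s)
    (s @^-1` [set v] `&` (fun xi => `|f xi - v|) @^-1` Y)).
  apply: fin_bigcup_measurable => // v _.
  apply: measurableI; first exact: borel_measurable_fiber.
  rewrite -[X in measurable X]setTI.
  have cv : continuous (fun x : H => `|x - v|).
    by move=> x; apply: cvg_norm; apply: cvgB => //; exact: cvg_cst.
  exact: (borel_measurable_comp cv mf).
apply/seteqP; split=> [xi Yxi|xi [_ _ [/= <- ]]//].
by exists (s xi).
Qed.

End BorelMeasurable.

(** * The Bochner integral commutes with inner products *)

Section BochnerDot.
Context (d : measure_display) (Xi : measurableType d) (R : realType)
        (P : probability Xi R) (H : completeNormedModType R)
        (ip : {dot H for idfun}) (ip_norm : norm_from_dot ip).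

Lemma measurable_dot (f : Xi -> H) (w : H) :
  borel_measurable f -> measurable_fun setT (fun xi => ip (f xi) w).
Proof.
exact: (@borel_measurable_comp _ _ _ _ (ip^~ w) f
  (@continuous_dot R H ip ip_norm w)).
Qed.

Lemma simple_dotE (s : Xi -> H) (w : H) (xi : Xi) : simple_fun s ->
  ip (s xi) w = \sum_(v <- fset_set (range s)) ip v w * \1_(s @^-1` [set v]) xi.
Proof.
move=> [_ fs].
have sxi : s xi \in fset_set (range s).
  by rewrite in_fset_set// mem_set//; exists xi.
(* Only the term v = s xi survives. *)
rewrite (big_fsetD1 _ sxi)/= indicE mem_set//= mulr1.
rewrite big_seq big1 ?addr0// => v; rewrite in_fsetD1 => /andP[vs _].
by rewrite indicE memNset ?mulr0//= => sv; rewrite sv eqxx in vs.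
Qed.

Lemma integrable_simple_term (s : Xi -> H) (w v : H) : simple_fun s ->
  P.-integrable setT (EFin \o (fun xi => ip v w * \1_(s @^-1` [set v]) xi)).
Proof.
move=> [ms _]; rewrite (_ : _ \o _ =
  fun xi => ((ip v w)%:E * (\1_(s @^-1` [set v]) xi)%:E)%E) //.
apply: integrableZl => //; apply: integrable_indic.
exact: borel_measurable_fiber.
Qed.

Lemma integrable_simple_dot (s : Xi -> H) (w : H) : simple_fun s ->
  P.-integrable setT (EFin \o (fun xi => ip (s xi) w)).
Proof.
move=> ss; rewrite (_ : _ \o _ = fun xi => (\sum_(v <- fset_set (range s))
    (ip v w * \1_(s @^-1` [set v]) xi)%:E)%E); last first.
  by apply/funext => xi /=; rewrite simple_dotE// sumEFin.
by apply: integrable_sum => // v _; exact: integrable_simple_term.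
Qed.

Lemma simple_integral_dot (s : Xi -> H) (w : H) : simple_fun s ->
  ip (simple_integral P s) w = \int[P]_xi ip (s xi) w.
Proof.
move=> ss; have [ms fs] := ss.
rewrite /simple_integral fsbig_finite//= /Rintegral.
under eq_integral do rewrite simple_dotE// -sumEFin.
rewrite integral_sum//; last by move=> v; exact: integrable_simple_term.
have mfib v : measurable (s @^-1` [set v]) by exact: borel_measurable_fiber.
rewrite (eq_bigr (fun v => (ip v w * fine (P (s @^-1` [set v])))%:E)).
  rewrite sumEFin/= -[LHS]/(applyr ip w _) raddf_sum.
  by apply: eq_bigr => v _; rewrite mulrC -dotZl.
move=> v _; under eq_integral do rewrite EFinM.
rewrite integralZl//; last exact: integrable_indic.
by rewrite integral_indic// setIT EFinM fineK//; exact: fin_num_measure.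
Qed.

(** By Cauchy-Schwarz, <f, w> - <s, w> is dominated by |w| |f - s|. This makes it integrable, so
    adding <s, w> back gives integrability of <f, w>; integrating the domination gives the
    estimate. *)
Lemma dot_simple_approx (f s : Xi -> H) (w : H) :
  borel_measurable f -> simple_fun s ->
  P.-integrable setT (EFin \o (fun xi => `|f xi - s xi|)) ->
  P.-integrable setT (EFin \o (fun xi => ip (f xi) w)) /\
  `|\int[P]_xi ip (f xi) w - ip (simple_integral P s) w|
    <= `|w| * \int[P]_xi `|f xi - s xi|.
Proof.
move=> mf ss ifs; have is_ := integrable_simple_dot w ss.
have iw : P.-integrable setT (EFin \o (fun xi => `|w| * `|f xi - s xi|)).
  exact: (integrableZl measurableT `|w| ifs).
have idiff : P.-integrable setT (EFin \o (fun xi => ip (f xi) w - ip (s xi) w)).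
  apply: le_integrable iw => //.
    apply/measurable_EFinP; apply: measurable_funB; first exact: measurable_dot.
    by apply: measurable_dot; case: ss.
  move=> xi _ /=; rewrite lee_fin -dotBl [leRHS]ger0_norm ?mulr_ge0// mulrC.
  exact: dot_le_norm.
have if_ : P.-integrable setT (EFin \o (fun xi => ip (f xi) w)).
  have := integrableD measurableT idiff is_.
  by congr (integrable _ _ _); apply/funext => xi /=; rewrite -EFinD subrK.
split=> //; rewrite simple_integral_dot// -RintegralB//.
rewrite -RintegralZl//; apply: le_trans (le_normr_Rintegral _ idiff) _ => //.
apply: le_Rintegral => //; first exact: integrable_abse idiff.
move=> xi _; rewrite -dotBl mulrC; exact: dot_le_norm.
Qed.

Lemma bochner_integral_dot (f : Xi -> H) (w : H) : bochner_integrable P f ->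
  P.-integrable setT (EFin \o (fun xi => ip (f xi) w)) /\
  ip (bochner_integral P f) w = \int[P]_xi ip (f xi) w.
Proof.
move=> [mf [s0 s0f]].
pose e (s : nat -> Xi -> H) n := \int[P]_xi `|f xi - s n xi|.
(* Stated for every approximating sequence: it serves first for [s0], then for the possibly
   different sequence behind the value selected by [get]. *)
have eP s : simple_approx P f s -> e s n @[n --> \oo] --> 0 /\
    \forall n \near \oo, forall w,
      P.-integrable setT (EFin \o (fun xi => ip (f xi) w)) /\
      `|\int[P]_xi ip (f xi) w - ip (simple_integral P (s n)) w| <= `|w| * e s n.
  move=> [ss /fine_cvgP[fin cvg0]]; split=> //.
  (* Convergence in the extended reals makes the mean error finite only for large n. *)
  near=> n => v; apply: dot_simple_approx => //.
  apply/integrableP; split.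
    by apply/measurable_EFinP; exact: measurable_normB.
  under eq_integral do rewrite /= normr_id.
  rewrite ltey_eq.
  by apply/orP; left; near: n.
have [e0 near0] := eP _ s0f.
split; first by have [n _ /(_ n (leqnn n) w)[]] := near0.
pose u n := simple_integral P (s0 n).
have cvgu : cvg (u n @[n --> \oo]).
  apply/cauchy_cvgP/cauchy_exP => eps eps0.
  have eps4 : 0 < eps / 4 by rewrite divr_gt0.
  have small : \forall n \near \oo, e s0 n < eps / 4.
    by move/cvgr_lt : e0; apply.
  have [N _ NP] := filterI near0 small.
  exists (u N); exists N => // n Nn.
  have [hn sn] := NP n Nn; have [hN sN] := NP N (leqnn N).
  rewrite /= -ball_normE /=.
  (* Testing the estimates against the difference v itself turns weak closeness into closeness in
     norm. *)
  set v := u N - u n.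
  have [->|v0] := eqVneq v 0; first by rewrite normr0.
  have vgt0 : 0 < `|v| by rewrite normr_gt0.
  have [_ Hn] := hn v; have [_ HN] := hN v.
  (* Both <u N, v> and <u n, v> lie within |v| eps/4 of the same integral, and their difference is
     |v|^2. *)
  have : `|v| ^+ 2 <= `|v| * (eps / 2).
    rewrite -(dot_normE ip_norm) {1}/v dotBl.
    move: Hn HN; rewrite -/(u n) -/(u N) !ler_norml.
    set I := Rintegral _ _ _ => /andP[Hn1 Hn2] /andP[HN1 HN2].
    have : `|v| * e s0 n <= `|v| * (eps / 4) by rewrite ler_pM2l// ltW.
    have : `|v| * e s0 N <= `|v| * (eps / 4) by rewrite ler_pM2l// ltW.
    by lra.
  rewrite expr2 ler_pM2l// => /le_lt_trans; apply; lra.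
have : exists v : H, exists2 s, simple_approx P f s &
    simple_integral P (s n) @[n --> \oo] --> v.
  by exists (lim (u n @[n --> \oo])), s0.
move=> /getPex; rewrite -/(bochner_integral P f) => -[s sf cvgs].
have {eP}[es0 nears] := eP _ sf.
have c1 : ip (simple_integral P (s n)) w @[n --> \oo] -->
    ip (bochner_integral P f) w.
  exact: cvg_comp cvgs (@continuous_dot R H ip ip_norm w (bochner_integral P f)).
(* The same real sequence also tends to the integral of <f, w>, so the two limits agree. *)
apply: norm_cvg_unique c1 _.
apply/cvgrPdist_le => eps eps0.
have c2 : `|w| * e s n @[n --> \oo] --> 0.
  by rewrite -[X in _ --> X](mulr0 `|w|); apply: cvgMr.
have := nears; have : \forall n \near \oo, `|w| * e s n < eps.
  by move/cvgr_lt : c2; apply.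
apply: filterS2 => n /ltW lt_eps /(_ w)[_ h].
exact: le_trans lt_eps.
Unshelve. all: by end_near. Qed.

End BochnerDot.

(** * Mean deviation of a random nonexpansive operator *)

Section RandomNonexpansive.
Context (d : measure_display) (Xi : measurableType d) (R : realType)
        (D : probability Xi R) (H : completeNormedModType R)
        (ip : {dot H for idfun}) (ip_norm : norm_from_dot ip)
        (T_ : Xi -> H -> H) (T : H -> H)
        (T_nonexpansive : {ae D, forall xi, nonexpansive (T_ xi)})
        (T_integrable : forall x : H, bochner_integrable D (fun xi => T_ xi x))
        (T_mean : forall x : H, T x = bochner_integral D (fun xi => T_ xi x)).

(* [|x - p| ^+ 2] stands for [|T_ xi x - T_ xi p| ^+ 2] in the expansion of
   [|T_ xi x - T_ xi p - (T x - T p)| ^+ 2]; this also makes the bound measurable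
   without measurability of sums of Borel maps. *)
Definition deviation_bound (x p : H) (xi : Xi) : R :=
  `|x - p| ^+ 2 - 2 * ip (T_ xi x - T_ xi p) (T x - T p) + `|T x - T p| ^+ 2.

Lemma ae_deviation_le (x p : H) :
  {ae D, forall xi, `|T_ xi x - T_ xi p - (T x - T p)| ^+ 2
                    <= deviation_bound x p xi}.
Proof.
apply: filterS T_nonexpansive => xi /(_ x p) Txp.
by rewrite (dot_normB ip_norm) /deviation_bound !lerD2r ler_sqr ?nnegrE.
Qed.

Lemma integrable_deviation (x p : H) :
  D.-integrable setT (EFin \o deviation_bound x p).
Proof.
have [ix _] := bochner_integral_dot ip_norm (T x - T p) (T_integrable x).
have [ip_ _] := bochner_integral_dot ip_norm (T x - T p) (T_integrable p).
have i1 := integrableZl measurableT 2 (integrableB measurableT ix ip_).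
have ic r : D.-integrable setT (fun=> r%:E).
  exact: finite_measure_integrable_cst.
have := integrableD measurableT
  (integrableB measurableT (ic (`|x - p| ^+ 2)) i1) (ic (`|T x - T p| ^+ 2)).
congr (integrable _ _ _); apply/funext => xi /=.
by rewrite /deviation_bound dotBl.
Qed.

(** With c = T x - T p, the cross term has mean -2 <c, c>, which combines with + |c|^2 to give -
    |c|^2. *)
Lemma integral_deviation (x p : H) :
  \int[D]_xi deviation_bound x p xi = `|x - p| ^+ 2 - `|T x - T p| ^+ 2.
Proof.
have [ix Ex] := bochner_integral_dot ip_norm (T x - T p) (T_integrable x).
have [ip_ Ep] := bochner_integral_dot ip_norm (T x - T p) (T_integrable p).
have i0 := integrableB measurableT ix ip_.
have i1 := integrableZl measurableT 2 i0.
have ic r : D.-integrable setT (fun=> r%:E).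
  exact: finite_measure_integrable_cst.
have i2 := integrableB measurableT (ic (`|x - p| ^+ 2)) i1.
have cstE r : \int[D]_(_ in setT) r = r :> R.
  rewrite Rintegral_cst// -[RHS]mulr1; congr (_ * _).
  exact: (congr1 fine (probability_setT D)).
under eq_Rintegral do rewrite /deviation_bound dotBl.
rewrite (RintegralD measurableT i2 (ic _)) (RintegralB measurableT (ic _) i1).
rewrite (RintegralZl _ measurableT i0) (RintegralB measurableT ix ip_).
rewrite !cstE -Ex -Ep -!T_mean -dotBl dot_normE//; ring.
Qed.

(** The bound dominates a square, so it is nonnegative almost surely and equals its absolute value
    there. The absolute value supplies an integrand that is nonnegative everywhere. *)
Lemma integral_norm_deviation (x p : H) :
  (\int[D]_xi (`|deviation_bound x p xi|)%:E
   = (`|x - p| ^+ 2 - `|T x - T p| ^+ 2)%:E)%E.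
Proof.
have idev := integrable_deviation x p.
have mdev := measurable_int _ idev.
rewrite -integral_deviation /Rintegral fineK ?integrable_fin_num//.
apply: ae_eq_integral => //.
  by apply: (measurableT_comp (f := abse)) mdev.
apply: filterS (ae_deviation_le x p) => xi dev_ge _.
by rewrite ger0_norm// (le_trans _ dev_ge)// sqr_ge0.
Qed.

Lemma ae_fix_displacement (p q : H) : Fix T p -> Fix T q ->
  {ae D, forall xi, T_ xi p - p = T_ xi q - q}.
Proof.
move=> Tp Tq; have := integral_norm_deviation p q.
rewrite Tp Tq subrr => int0.
have mdev := measurable_int _ (integrable_deviation p q).
have /(ae_eq_integral_abs _ measurableT mdev) dev0 :
  (\int[D]_xi `|(EFin \o deviation_bound p q) xi| = 0)%E by [].
(* Where the bound vanishes, so does the square below it. *)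
apply: filterS2 dev0 (ae_deviation_le p q) => xi /(_ I) /= [->].
rewrite Tp Tq exprn_even_le0//= normr_eq0 => /eqP disp0.
by apply/eqP; rewrite -subr_eq0 -disp0 !opprB addrACA [eqbRHS]addrACA [- p - _]addrC.
Qed.

Lemma measurable_normB_sqr (x v : H) :
  measurable_fun setT (fun xi => `|T_ xi x - v| ^+ 2).
Proof.
have cv : continuous (fun y : H => `|y - v| ^+ 2).
  move=> y; apply: cvgM; apply: cvg_norm; apply: cvgB => //; exact: cvg_cst.
exact: (borel_measurable_comp cv (T_integrable x).1).
Qed.

End RandomNonexpansive.

(** After the triangle inequality, the gap is the square of |x| - |y|. *)
Lemma sqr_normD_le (R : realType) (V : normedModType R) (x y : V) :
  `|x + y| ^+ 2 <= 2 * `|x| ^+ 2 + 2 * `|y| ^+ 2.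
Proof.
have : `|x + y| ^+ 2 <= (`|x| + `|y|) ^+ 2.
  by rewrite ler_sqr ?nnegrE ?addr_ge0// ler_normD.
have := sqr_ge0 (`|x| - `|y|); nra.
Qed.

Theorem mainTheorem2 (R : realType)
  (H : completeNormedModType R) (ip : {dot H for idfun})
  (H_hilbert : norm_from_dot ip) (H_separable : separable H)
  (d : measure_display) (Xi : measurableType d) (D : probability Xi R)
  (T_ : Xi -> H -> H)
  (T_nonexpansive : {ae D, forall xi, nonexpansive (T_ xi)})
  (T_measurable : forall x : H, borel_measurable (fun xi => T_ xi x))
  (T_integrable : forall x : H, bochner_integrable D (fun xi => T_ xi x))
  (T : H -> H)
  (T_mean : forall x : H, T x = bochner_integral D (fun xi => T_ xi x))
  (Fix_nonempty : Fix T !=set0)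
  (sigma2 : R)
  (sigma2_bound : exists2 p0 : H, Fix T p0 &
     ('E_D[(fun xi => `|T_ xi p0 - T p0| ^+ 2)%R] <= sigma2%:E)%E) :
  forall x p : H, Fix T p ->
    ('E_D[(fun xi => `|T_ xi x - T x| ^+ 2)%R]
       <= (2 * sigma2 + 2 * `|x - p| ^+ 2)%:E)%E.
Proof.
move=> x p Tp; have [p0 Tp0] := sigma2_bound; rewrite unlock => sigma_p0.
have msqr := measurable_normB_sqr T_integrable.
(* The bound moves from p0 to p: almost surely the displacements at the two fixed points coincide,
   so the two variances are equal. *)
have sigma_p : (\int[D]_xi (`|T_ xi p - T p| ^+ 2)%:E <= sigma2%:E)%E.
  apply: le_trans sigma_p0; rewrite le_eqVlt; apply/orP; left; apply/eqP.
  apply: ae_eq_integral => //; try exact/measurable_EFinP/msqr.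
  have := ae_fix_displacement H_hilbert T_nonexpansive T_integrable T_mean Tp Tp0.
  by apply: filterS => xi dE _; rewrite Tp Tp0 dE.
have idev := integrable_deviation H_hilbert T T_integrable x p.
have mdev : measurable_fun setT (fun xi => `|deviation_bound ip T_ T x p xi|).
  by apply: measurableT_comp => //; exact/measurable_EFinP/(measurable_int D).
(* The absolute value makes [g] nonnegative everywhere, so its integral splits without any
   integrability of the variance term. *)
pose g xi := 2 * `|T_ xi p - T p| ^+ 2 + 2 * `|deviation_bound ip T_ T x p xi|.
apply: (@le_trans _ _ (\int[D]_xi (g xi)%:E)%E).
  apply: ae_ge0_le_integral => //.
  - exact/measurable_EFinP/msqr.
  - by move=> xi _; rewrite lee_fin addr_ge0// mulr_ge0// sqr_ge0.
  - apply/measurable_EFinP; apply: measurable_funD; apply: measurable_funM => //.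
  apply: filterS (ae_deviation_le H_hilbert T T_nonexpansive x p) => xi dev_ge _.
  rewrite lee_fin.
  have -> : T_ xi x - T x = (T_ xi p - T p) + (T_ xi x - T_ xi p - (T x - T p)).
    by rewrite opprB addrACA [T_ xi p + _]addrC subrK addKr.
  apply: le_trans (sqr_normD_le _ _) _.
  rewrite lerD2l ler_pM2l//; exact: le_trans (ler_norm _).
under eq_integral do rewrite EFinD EFinM [X in (_ + X)%E]EFinM.
have mp : measurable_fun setT (fun xi => (`|T_ xi p - T p| ^+ 2)%:E).
  exact/measurable_EFinP/msqr.
have md : measurable_fun setT (fun xi => (`|deviation_bound ip T_ T x p xi|)%:E).
  exact/measurable_EFinP.
rewrite ge0_integralD//; last 2 first.
- exact: measurable_funeM.
- exact: measurable_funeM.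
rewrite !ge0_integralZl//.
rewrite (integral_norm_deviation H_hilbert T_nonexpansive T_integrable T_mean).
rewrite [leRHS]EFinD; apply: leeD.
  by rewrite EFinM lee_pmul2l.
(* The term - |T x - T p|^2 is dropped. *)
by rewrite -EFinM lee_fin ler_pM2l// gerBl sqr_ge0.
Qed.
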